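(* There exists an absolute constant $c$ such that for every positive integer $m$ and every prime power $q$ with $3\mid q-1$ and $q>\max\{42m,c\}+1$, there exists a family $\{(A_i,S_i)\}_{i=1}^{4m}$, where each $A_i$ is an invertible $3^m\times 3^m$ matrix over $\mathbb{F}_q$ and each $S_i$ is a $3^{m-1}$-dimensional subspace of $\mathbb{F}_q^{3^m}$, which satisfies the subspace condition with $r=3$ and $\ell=3^m$.
   Context: Vectors are row vectors and matrices act on the right: for a subspace $S\subseteq\mathbb{F}_q^\ell$ and an $\ell\times\ell$ matrix $M$, $SM=\{sM: s\in S\}$; $U+V=\{u+v:u\in U,v\in V\}$. Let $r,\ell$ be integers with $r\mid\ell$. A family $\{(A_i,S_i)\}_{i=1}^k$, where each $A_i$ is an invertible $\ell\times\ell$ matrix over $\mathbb{F}_q$ and each $S_i$ is an $(\ell/r)$-dimensional subspace of $\mathbb{F}_q^\ell$, satisfies the subspace condition (for $r$ and $\ell$) if: (Independence) for every $i$, $S_i+S_iA_i+\dots+S_iA_i^{r-1}=\mathbb{F}_q^\ell$; (Invariance) for all $i\ne j$, $S_iA_j=S_i$; (Nonsingularity) every square block submatrix (obtained by choosing $t$ block rows and $t$ block columns, for any $t$) of the $k\times r$ block matrix whose $(i,j)$ block is $A_i^{j}$, $i=1,\dots,k$, $j=0,\dots,r-1$ (with $A_i^0=I$), is invertible. *)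

(* Defs.v *)
From HB Require Import structures.
From mathcomp Require Import all_boot all_order all_algebra all_fingroup all_field.
Set Implicit Arguments. Unset Strict Implicit. Unset Printing Implicit Defensive.
Import GRing.Theory.
Local Open Scope ring_scope.

(* Subspaces of F^l are represented by row spaces of l x l matrices (mxalgebra).
   S *m A is the subspace SA = {sA : s in S}; (_ + _)%MS is the subspace sum. *)

Definition block_submx (F : fieldType) (l k r t : nat) (A : 'I_k -> 'M[F]_l)
  (rows : 'I_t -> 'I_k) (cols : 'I_t -> 'I_r) :
  'M[F]_(\sum_(a < t) l) :=
  \mxblock_(a < t, b < t) (A (rows a) ^+ (nat_of_ord (cols b))).

Definition subspace_condition (F : fieldType) (r l k : nat)
  (A : 'I_k -> 'M[F]_l) (S : 'I_k -> 'M[F]_l) : Prop :=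
  (forall i, A i \in unitmx) /\
  (forall i, \rank (S i) = (l %/ r)%N) /\
  (forall i, (\sum_(j < r) (S i *m (A i ^+ j)) == 1%:M)%MS) /\
  (forall i j, i != j -> (S i *m A j == S i)%MS) /\
  (forall (t : nat) (rows : 'I_t -> 'I_k) (cols : 'I_t -> 'I_r),
      injective rows -> injective cols ->
      block_submx A rows cols \in unitmx).

Arguments subspace_condition {F} r l {k} A S.

(* Main.v *)
(* Identify F^3 with F^4 / <(1,1,1,1)> and let v_0, ..., v_3 be the images of the
   unit vectors. For each j the v_i with i != j form a basis, and M_j is the map
   with v_i M_j = f(j,i) v_i for i != j; then v_j is cyclic for M_j and an
   eigenvector of every other M_k. On the m-fold tensor power of F^3 let
   A_(j,i) be M_j acting on the i-th factor, with S_(j,i) spanned by the tensors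
   whose i-th factor is v_j.
   Matrices on different factors commute, so every block minor involving two
   factors reduces to the invertibility of A - B and A^2 - B^2, which holds as
   soon as distinct factors use eigenvalues with distinct squares. Inside one
   factor the 3 x 3 block minor of M_a, M_b, M_c is nonzero exactly when the
   quadratics (X - f(b,a))(X - f(c,a)), (X - f(a,b))(X - f(c,b)) and
   (X - f(a,c))(X - f(b,c)) are linearly independent. Four eigenvalues per
   factor can be arranged so that this always holds. In total 4m elements with
   distinct nonzero squares are needed, so c = 0 suffices. *)
Require Import Defs.
From HB Require Import structures.
From mathcomp Require Import all_boot all_order all_algebra all_fingroup all_field.
From mathcomp Require Import ring zify mxtens.
Set Implicit Arguments. Unset Strict Implicit. Unset Printing Implicit Defensive.
Import GRing.Theory.
Local Open Scope ring_scope.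

(** * Linear algebra *)

Lemma unitmx_inj (F : fieldType) n (A : 'M[F]_n) :
  (forall u : 'rV_n, u *m A = 0 -> u = 0) -> A \in unitmx.
Proof. by move/inj_row_free; rewrite row_free_unit. Qed.

Lemma unitmx_ker (F : fieldType) n p (A : 'M[F]_n) (u : 'M_(p, n)) :
  A \in unitmx -> u *m A = 0 -> u = 0.
Proof. by move=> uA u0; rewrite -[u](mulmxK uA) u0 mul0mx. Qed.

Lemma row_mul_inj (F : fieldType) n p (A B : 'M[F]_(n, p)) :
  (forall u : 'rV_n, u *m A = u *m B) -> A = B.
Proof. by move=> E; apply/row_matrixP=> i; rewrite !rowE E. Qed.

Lemma vandermonde3 (F : fieldType) (x y z a b c : F) : x != y -> x != z -> y != z ->
  a + b + c = 0 -> x * a + y * b + z * c = 0 ->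
  x ^+ 2 * a + y ^+ 2 * b + z ^+ 2 * c = 0 -> [/\ a = 0, b = 0 & c = 0].
Proof.
move=> nxy nxz nyz E0 E1 E2.
have Ea : (x - y) * (x - z) * a = 0.
  have -> : (x - y) * (x - z) * a = (x ^+ 2 * a + y ^+ 2 * b + z ^+ 2 * c)
     - (y + z) * (x * a + y * b + z * c) + y * z * (a + b + c) by ring.
  by rewrite E0 E1 E2; ring.
have Eb : (y - x) * (y - z) * b = 0.
  have -> : (y - x) * (y - z) * b = (x ^+ 2 * a + y ^+ 2 * b + z ^+ 2 * c)
     - (x + z) * (x * a + y * b + z * c) + x * z * (a + b + c) by ring.
  by rewrite E0 E1 E2; ring.
have a0 : a = 0.
  by move/eqP: Ea; rewrite !mulf_eq0 !subr_eq0 (negbTE nxy) (negbTE nxz) => /eqP.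
have b0 : b = 0.
  move/eqP: Eb; rewrite !mulf_eq0 !subr_eq0 eq_sym (negbTE nxy) (negbTE nyz).
  by move/eqP.
by split=> //; move: E0; rewrite a0 b0 !add0r.
Qed.

Lemma quadratic_eq0 (F : fieldType) (x y z a b c : F) : x != y -> x != z -> y != z ->
  a + b * x + c * x ^+ 2 = 0 -> a + b * y + c * y ^+ 2 = 0 ->
  a + b * z + c * z ^+ 2 = 0 -> [/\ a = 0, b = 0 & c = 0].
Proof.
move=> nxy nxz nyz Ex Ey Ez.
have Exy : b + c * (x + y) = 0.
  apply: (mulfI (x := x - y)); first by rewrite subr_eq0.
  by rewrite mulr0 -[RHS](subrr 0) -{1}Ex -Ey; ring.
have Exz : b + c * (x + z) = 0.
  apply: (mulfI (x := x - z)); first by rewrite subr_eq0.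
  by rewrite mulr0 -[RHS](subrr 0) -{1}Ex -Ez; ring.
have c0 : c = 0.
  apply: (mulfI (x := y - z)); first by rewrite subr_eq0.
  by rewrite mulr0 -[RHS](subrr 0) -{1}Exy -Exz; ring.
have b0 : b = 0 by move: Exy; rewrite c0 mul0r addr0.
by move: Ex; rewrite b0 c0 !mul0r !addr0.
Qed.

Lemma big_ord4_uniq (V : nmodType) (a b c d : 'I_4) (f : 'I_4 -> V) :
  uniq [:: a; b; c; d] -> \sum_i f i = f a + f b + f c + f d.
Proof.
move=> u4; have full i : i \in [:: a; b; c; d].
  have /subset_cardP/(_ (subset_predT _)) -> // : #|[:: a; b; c; d]| = #|'I_4|.
  by rewrite (card_uniqP u4) card_ord.
rewrite (eq_bigl (fun i => i \in [:: a; b; c; d])) => [|i]; last by rewrite full.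
by rewrite -big_uniq // !big_cons big_nil /= !addrA addr0.
Qed.

Lemma complete4 (i j : 'I_4) : i != j -> exists k l, uniq [:: i; j; k; l].
Proof.
move=> nij; have /cards2P[k [l [nkl E]]] : #|~: [set i; j]| == 2%N.
  by rewrite cardsCs setCK cards2 nij card_ord.
have := set21 k l; have := set22 k l; rewrite -E !inE !negb_or.
move=> /andP[li lj] /andP[ki kj]; exists k, l.
by rewrite /= !inE !negb_or nij nkl [i == k]eq_sym [i == l]eq_sym
  [j == k]eq_sym [j == l]eq_sym ki li kj lj.
Qed.

(** * Block Vandermonde matrices *)

(* When A - C and B - C are invertible, this is up to sign and invertible factors
   the Schur complement left in the 3 x 3 block Vandermonde matrix of A, B, C;
   being a ring expression, it is transported by ring morphisms. *)
Definition schur3 (F : fieldType) n (A B C : 'M[F]_n) : 'M_n :=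
  invmx (A - C) *m (A ^+ 2 - C ^+ 2) - invmx (B - C) *m (B ^+ 2 - C ^+ 2).

Section BlockVandermonde.
Variables (F : fieldType) (l : nat).
Implicit Types (A B C : 'M[F]_l) (u v w : 'rV[F]_l).

Lemma unitmxX A k : A \in unitmx -> A ^+ k \in unitmx.
Proof.
by move=> uA; elim: k => [|k IHk]; rewrite ?unitmx1 // exprS unitmx_mul uA.
Qed.

Lemma block_submx_unit k r t (A : 'I_k -> 'M[F]_l) (rows : 'I_t -> 'I_k)
    (cols : 'I_t -> 'I_r) :
  (forall w : 'I_t -> 'rV_l,
     (forall b, \sum_a w a *m A (rows a) ^+ cols b = 0) -> forall a, w a = 0) ->
  block_submx A rows cols \in unitmx.
Proof.
move=> inj; apply: unitmx_inj => w w0.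
have w_0 a : submxrow w a = 0.
  apply: (inj (submxrow w)) => b; have := congr1 (fun x => submxrow x b) w0.
  by rewrite -{1}[w]submxrowK mul_mxrow_mxblock mxrowK submxrow0.
rewrite -[w]submxrowK -[RHS]submxrowK.
by apply: eq_mxrow => a; rewrite submxrow0 w_0.
Qed.

(** This is triviality of the left kernel of the 3 x 3 block Vandermonde matrix, kept as three
    blocks so that the matrices can be rotated. *)
Definition vand3_inj A B C := forall u v w,
  u + v + w = 0 -> u *m A + v *m B + w *m C = 0 ->
  u *m A ^+ 2 + v *m B ^+ 2 + w *m C ^+ 2 = 0 -> [/\ u = 0, v = 0 & w = 0].

Lemma vand3_inj_rot A B C : vand3_inj A B C -> vand3_inj B C A.
Proof.
move=> inj u v w E0 E1 E2.
by have [|||-> -> ->] := inj w u v; rewrite // -addrA addrC.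
Qed.

(** Eliminating w leaves u(A - C) = - v(B - C); with x for this common vector, the third equation
    becomes x [schur3] = 0. *)
Lemma vand3_inj_schur A B C : A - C \in unitmx -> B - C \in unitmx ->
  schur3 A B C \in unitmx -> vand3_inj A B C.
Proof.
move=> uAC uBC uS u v w E0 E1 E2.
have Ew : w = - u - v by apply/eqP; rewrite -opprD -addr_eq0 addrC E0.
have Ex : u *m (A - C) = - (v *m (B - C)).
  apply/eqP; rewrite -addr_eq0 !mulmxBr -E1 Ew mulmxBl mulNmx.
  by rewrite addrACA -addrA.
have Es : u *m (A ^+ 2 - C ^+ 2) + v *m (B ^+ 2 - C ^+ 2) = 0.
  by rewrite !mulmxBr -E2 Ew mulmxBl mulNmx addrACA -addrA.
have u0 : u = 0.
  apply: (unitmx_ker uAC); apply: (unitmx_ker uS).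
  rewrite /schur3 mulmxBr !mulmxA mulmxK // Ex !mulNmx mulmxK //.
  by rewrite opprK.
have v0 : v = 0.
  by apply: (unitmx_ker uBC); apply/eqP; rewrite -oppr_eq0 -Ex u0 mul0mx.
by split=> //; rewrite Ew u0 v0 subr0 oppr0.
Qed.

(** Since A^2 - C^2 = (A - C)(A + C), and likewise for B, [schur3] collapses to (A + C) - (B + C) =
    A - B. Only C has to commute with the others: A and B may lie in the same tensor factor. *)
Lemma vand3_inj_comm A B C : A *m C = C *m A -> B *m C = C *m B ->
  A - C \in unitmx -> B - C \in unitmx -> A - B \in unitmx -> vand3_inj A B C.
Proof.
move=> cAC cBC uAC uBC uAB; apply: vand3_inj_schur => //.
have sqrB X : X *m C = C *m X -> X ^+ 2 - C ^+ 2 = (X - C) *m (X + C).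
  move=> cXC; rewrite !expr2 -!mulmxE mulmxBl !mulmxDr cXC.
  by rewrite opprD addrA addrK.
by rewrite /schur3 !sqrB // !mulKmx // opprD addrACA subrr addr0.
Qed.

Lemma vand2_inj A B j k u v : (j < k <= 2)%N -> A \in unitmx -> B \in unitmx ->
  (forall d, (0 < d <= 2)%N -> A ^+ d - B ^+ d \in unitmx) ->
  u *m A ^+ j + v *m B ^+ j = 0 -> u *m A ^+ k + v *m B ^+ k = 0 ->
  u = 0 /\ v = 0.
Proof.
move=> /andP[ltjk lek] uA uB uAB Ej.
rewrite -(subnKC (ltnW ltjk)) !exprD -!mulmxE !mulmxA.
have Ev : v *m B ^+ j = - (u *m A ^+ j) by apply/eqP; rewrite -addr_eq0 addrC Ej.
rewrite Ev mulNmx -mulmxBr => Ek.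
have u0 : u *m A ^+ j = 0.
  apply: unitmx_ker Ek; apply: uAB; rewrite subn_gt0 ltjk /=.
  by rewrite (leq_trans (leq_subr _ _)).
split; first exact: unitmx_ker (unitmxX j uA) u0.
by apply: (unitmx_ker (unitmxX j uB)); rewrite Ev u0 oppr0.
Qed.

Lemma block_submx3_unit k (A : 'I_k -> 'M[F]_l) :
  (forall p, A p \in unitmx) ->
  (forall p q d, p != q -> (0 < d <= 2)%N -> A p ^+ d - A q ^+ d \in unitmx) ->
  (forall p q s, p != q -> p != s -> q != s -> vand3_inj (A p) (A q) (A s)) ->
  forall t (rows : 'I_t -> 'I_k) (cols : 'I_t -> 'I_3),
  injective rows -> injective cols -> block_submx A rows cols \in unitmx.
Proof.
move=> uA u2 u3 t rows cols rinj cinj; apply: block_submx_unit => w Ew.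
have := leq_card _ cinj; rewrite !card_ord => let3.
case: t => [|[|[|[|t]]]] // in rows cols w rinj cinj Ew let3 *; first by case.
- move=> a; have := Ew a; rewrite big_ord1 (ord1 a).
  exact/unitmx_ker/unitmxX/uA.
- have E b : w 0 *m A (rows 0) ^+ cols b + w 1 *m A (rows 1) ^+ cols b = 0.
    rewrite -[RHS](Ew b) !big_ord_recl big_ord0 addr0.
    by congr (_ + w _ *m A (rows _) ^+ _); apply: val_inj.
  have nr : rows 0 != rows 1 by rewrite (inj_eq rinj).
  have key b b' : (cols b < cols b')%N -> w 0 = 0 /\ w 1 = 0.
    move=> lt_bb'; apply: vand2_inj (E b) (E b') => //; last by move=> d; apply: u2.
    by rewrite lt_bb' -ltnS ltn_ord.
  have [w0 w1] : w 0 = 0 /\ w 1 = 0.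
    case: (ltngtP (cols 0) (cols 1)) => [/key|/key|/val_inj/cinj] //.
  move=> a; case: (unliftP 0 a) => [b|] -> //; rewrite (ord1 b).
  by have -> : lift 0 0 = 1 :> 'I_2 by apply: val_inj.
- have ntr (i j : 'I_3) : i != j -> rows i != rows j by rewrite (inj_eq rinj).
  have E k0 : (k0 < 3)%N -> w 0 *m A (rows 0) ^+ k0 + w 1 *m A (rows 1) ^+ k0
       + w 2%:R *m A (rows 2%:R) ^+ k0 = 0.
    (* Three distinct columns out of three exhaust them, so each power 0, 1, 2 occurs. *)
    move=> lk; have [g _ gK] := injF_bij cinj.
    rewrite -[RHS](Ew (g (Ordinal lk))) gK !big_ord_recl big_ord0 addr0 addrA.
    by congr (_ + w _ *m A (rows _) ^+ _ + w _ *m A (rows _) ^+ _); apply: val_inj.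
  have [||| w0 w1 w2] := u3 _ _ _
    (ntr 0 1 isT) (ntr 0 2%:R isT) (ntr 1 2%:R isT) (w 0) (w 1) (w 2%:R).
  - by have := E 0 isT; rewrite !mulmx1.
  - by have := E 1 isT.
  - exact: E 2 isT.
  move=> [[|[|[|?]]] Ha] //.
  - by rewrite -w0; congr w; apply: val_inj.
  - by rewrite -w1; congr w; apply: val_inj.
  - by rewrite -w2; congr w; apply: val_inj.
Qed.

End BlockVandermonde.

(** * Transport along ring morphisms of matrix algebras *)

Section Morphism.
Variables (F : fieldType) (n l : nat) (f : {rmorphism 'M[F]_n -> 'M[F]_l}).

Lemma rmorph_unitmx A : A \in unitmx -> f A \in unitmx.
Proof.
move=> uA; suff /mulmx1_unit[] : f A *m f (invmx A) = 1%:M by [].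
by rewrite -[LHS]rmorphM -mulmxE mulmxV // rmorph1.
Qed.

Lemma rmorph_invmx A : A \in unitmx -> f (invmx A) = invmx (f A).
Proof.
move=> uA; rewrite -[LHS](mulKmx (rmorph_unitmx uA)) -[X in _ *m X]rmorphM.
by rewrite -mulmxE mulmxV // rmorph1 mulmx1.
Qed.

Lemma rmorph_schur3 A B C : A - C \in unitmx -> B - C \in unitmx ->
  f (schur3 A B C) = schur3 (f A) (f B) (f C).
Proof.
move=> uAC uBC; rewrite /schur3 rmorphB; congr (_ - _).
  by rewrite -!rmorphB -rmorph_invmx // -!rmorphXn -rmorphB -[RHS]rmorphM.
by rewrite -!rmorphB -rmorph_invmx // -!rmorphXn -rmorphB -[RHS]rmorphM.
Qed.

End Morphism.

(** If uA = uB, commutation makes each product of factors A - c_i act on u like the same product in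
    B. The full product is 0 for A and invertible for B, so u = 0. *)
Lemma comm_sub_unitmx (F : fieldType) l (A B : 'M[F]_l) (I : finType) (c : I -> F) :
  A *m B = B *m A -> \prod_i (A - (c i)%:M) = 0 ->
  (forall i, B - (c i)%:M \in unitmx) -> A - B \in unitmx.
Proof.
move=> cAB A0 uB; apply: unitmx_inj => u; rewrite mulmxBr => /eqP.
rewrite subr_eq0 => /eqP uAB.
have E (r : seq I) v : v *m A = v *m B ->
    v *m \prod_(i <- r) (A - (c i)%:M) = v *m \prod_(i <- r) (B - (c i)%:M).
  elim: r v => [|i r IHr] v vAB; first by rewrite !big_nil.
  have vAcBc : v *m (A - (c i)%:M) = v *m (B - (c i)%:M) by rewrite !mulmxBr vAB.
  rewrite !big_cons -!mulmxE !mulmxA -vAcBc IHr // !mulmxBr !mulmxBl.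
  by rewrite -!mulmxA cAB !mulmxA vAB -!mulmxA -!scalar_mxC !mulmxA vAB.
apply: (@unitmx_ker _ _ _ (\prod_i (B - (c i)%:M))).
  elim/big_ind: _ => [|C D uC uD|i _]; rewrite ?unitmx1 //.
  by rewrite unitmx_mul uC.
by rewrite -E // A0 mulmx0.
Qed.

(** * Four matrices on F^3 *)

(* The projection F^4 -> F^4 / <(1,1,1,1)> = F^3. *)
Definition pi4 (F : fieldType) (x : 'I_4 -> F) : 'rV[F]_3 :=
  \row_k (x (lift ord0 k) - x ord0).

(* The diagonal matrix g in the basis (v_i)_(i != j); g j is irrelevant. *)
Definition quot_diag (F : fieldType) (j : 'I_4) (g : 'I_4 -> F) : 'M[F]_3 :=
  \matrix_r pi4 (fun i => g i * ((lift ord0 r == i)%:R - (lift ord0 r == j)%:R)).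

Section QuotDiag.
Variable F : fieldType.
Implicit Types (x y g h : 'I_4 -> F) (i j : 'I_4) (u : 'rV[F]_3).

Lemma pi4_surj u : exists x, u = pi4 x.
Proof.
exists (fun i => if unlift ord0 i is Some k then u 0 k else 0).
by apply/rowP => k; rewrite !mxE liftK unlift_none subr0.
Qed.

Lemma pi4_eqP x y : pi4 x = pi4 y <-> forall i, x i - y i = x ord0 - y ord0.
Proof.
split=> [/rowP eq_xy i | eq_xy].
  case: (unliftP ord0 i) => [k|] -> //.
  have := eq_xy k; rewrite !mxE => /eqP; rewrite subr_eq => /eqP ->; ring.
apply/rowP=> k; rewrite !mxE; have := eq_xy (lift ord0 k).
move/eqP; rewrite subr_eq => /eqP ->; ring.
Qed.

Lemma pi4_eq0 x i0 : pi4 x = 0 <-> forall i, x i = x i0.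
Proof.
have -> : 0 = pi4 (fun=> 0) :> 'rV[F]_3 by apply/rowP=> k; rewrite !mxE subr0.
rewrite pi4_eqP; split=> [E i|E i]; last by rewrite !subr0 E (E ord0).
by have := E i; have := E i0; rewrite !subr0 => -> ->.
Qed.

Lemma pi4D x y : pi4 x + pi4 y = pi4 (fun i => x i + y i).
Proof. by apply/rowP=> k; rewrite !mxE; ring. Qed.

Lemma pi4N x : - pi4 x = pi4 (fun i => - x i).
Proof. by apply/rowP=> k; rewrite !mxE; ring. Qed.

Lemma pi4Z (c : F) x : c *: pi4 x = pi4 (fun i => c * x i).
Proof. by apply/rowP=> k; rewrite !mxE mulrBr. Qed.

(** Subtracting x_j (1,1,1,1) from x gives the representative that vanishes at j; its entries are
    the coordinates in the basis (v_i) with i != j. *)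
Lemma mul_pi4_diag x j g :
  pi4 x *m quot_diag j g = pi4 (fun i => g i * (x i - x j)).
Proof.
apply/rowP=> c; rewrite !mxE !big_ord_recl big_ord0 !mxE.
have four : forall k : 'I_4, [\/ k = 0, k = 1, k = 2%:R | k = 3%:R].
  by move=> [[|[|[|[|k]]]] Hk] //;
    [constructor 1|constructor 2|constructor 3|constructor 4]; apply: val_inj.
have -> : lift ord0 (0 : 'I_3) = 1 :> 'I_4 by apply: val_inj.
have -> : lift ord0 (lift 0 0 : 'I_3) = 2%:R :> 'I_4 by apply: val_inj.
have -> : lift ord0 (lift 0 (lift 0 0) : 'I_3) = 3%:R :> 'I_4 by apply: val_inj.
have -> : ord0 = 0 :> 'I_4 by [].
by case: (four j) => ->; case: (four (lift ord0 c)) => -> /=; ring.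
Qed.

Lemma eq_quot_diag j g h :
  (forall i, i != j -> g i = h i) -> quot_diag j g = quot_diag j h.
Proof.
move=> E; apply: row_mul_inj => u; have [x ->] := pi4_surj u.
rewrite !mul_pi4_diag; apply/pi4_eqP.
have H i : g i * (x i - x j) - h i * (x i - x j) = 0.
  by have [->|/E ->] := eqVneq i j; rewrite ?subrr ?mulr0 ?subrr.
by move=> i; rewrite !H.
Qed.

Lemma quot_diagM j g h :
  quot_diag j g * quot_diag j h = quot_diag j (fun i => g i * h i).
Proof.
apply: row_mul_inj => u; have [x ->] := pi4_surj u.
rewrite mulmxA !mul_pi4_diag; apply/pi4_eqP => i.
by ring.
Qed.

Lemma quot_diagB j g h :
  quot_diag j g - quot_diag j h = quot_diag j (fun i => g i - h i).
Proof.
apply: row_mul_inj => u; have [x ->] := pi4_surj u.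
rewrite mulmxBr !mul_pi4_diag pi4N pi4D; apply/pi4_eqP => i; ring.
Qed.

Lemma quot_diag_const j (c : F) : quot_diag j (fun=> c) = c%:M.
Proof.
apply: row_mul_inj => u; have [x ->] := pi4_surj u.
rewrite mul_pi4_diag mul_mx_scalar; apply/rowP => k; rewrite !mxE; ring.
Qed.

Lemma quot_diagX j g d : quot_diag j g ^+ d = quot_diag j (fun i => g i ^+ d).
Proof.
elim: d => [|d IHd]; first by rewrite expr0 -idmxE -(quot_diag_const j).
by rewrite exprS IHd quot_diagM; apply: eq_quot_diag => i _; rewrite exprS.
Qed.

Lemma quot_diag_prod (I : Type) (r : seq I) j (g : I -> 'I_4 -> F) :
  \prod_(a <- r) quot_diag j (g a) = quot_diag j (fun i => \prod_(a <- r) g a i).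
Proof.
elim: r => [|a r IHr].
  rewrite big_nil -idmxE -(quot_diag_const j).
  by apply: eq_quot_diag => i; rewrite big_nil.
by rewrite big_cons IHr quot_diagM; apply: eq_quot_diag => i _; rewrite big_cons.
Qed.

Lemma quot_diag_unit j g :
  (forall i, i != j -> g i != 0) -> quot_diag j g \in unitmx.
Proof.
move=> nz.
suff /mulmx1_unit[] : quot_diag j g *m quot_diag j (fun i => (g i)^-1) = 1%:M by [].
rewrite mulmxE quot_diagM -(quot_diag_const j).
by apply: eq_quot_diag => i /nz; exact: divff.
Qed.

End QuotDiag.

(* The table, rows indexed by j:  - 0 1 2 / 2 - 0 1 / 3 2 - 0 / 0 3 2 - .
   It is chosen so that for each missing index d, the three pairs
   {label j i | j != d, i} form a path on the four labels. *)
Definition label (j i : 'I_4) : 'I_4 :=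
  inZp (if (j < i)%N then (i - j).-1 else (j - i).+1).

(** This makes the three eigenvalues of M_j distinct, hence v_j cyclic. *)
Lemma label_row (j i i' : 'I_4) :
  i != j -> i' != j -> label j i = label j i' -> i = i'.
Proof.
move=> nij ni'j /eqP eqL; apply/eqP; move: nij ni'j eqL.
by case: j i i' => [[|[|[|[|?]]]] ?] [[|[|[|[|?]]]] ?] [[|[|[|[|?]]]] ?].
Qed.

(** This separates the eigenvalues of different matrices on their common eigenvector v_i. *)
Lemma label_col (j j' i : 'I_4) :
  i != j -> i != j' -> label j i = label j' i -> j = j'.
Proof.
move=> nij nij' /eqP eqL; apply/eqP; move: nij nij' eqL.
by case: j j' i => [[|[|[|[|?]]]] ?] [[|[|[|[|?]]]] ?] [[|[|[|[|?]]]] ?].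
Qed.

Lemma label_anti (i j : 'I_4) : label i j = label j i -> i = j.
Proof.
move=> /eqP eqL; apply/eqP; move: eqL.
by case: i j => [[|[|[|[|?]]]] ?] [[|[|[|[|?]]]] ?].
Qed.

Definition base_mx (F : fieldType) (e : 'I_4 -> F) (j : 'I_4) : 'M[F]_3 :=
  quot_diag j (fun i => e (label j i)).

Definition base_vec (F : fieldType) (j : 'I_4) : 'rV[F]_3 :=
  pi4 (fun i => (i == j)%:R).

(** * The matrices M_j: differences, common eigenvectors and cyclic vectors *)

Section Base.
Variables (F : fieldType) (e : 'I_4 -> F).
Hypothesis e_neq0 : forall a, e a != 0.
Hypothesis e2_inj : injective (fun a => e a ^+ 2).
Local Notation M := (base_mx e).

Lemma ed_inj d : (0 < d <= 2)%N -> injective (fun a => e a ^+ d).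
Proof.
case: d => [|[|[|d]]] //= _ a b //; rewrite !expr1 => eab.
by apply: e2_inj; rewrite /= eab.
Qed.

Lemma e_inj : injective e.
Proof. by move=> a b eab; apply: e2_inj; rewrite /= eab. Qed.

Lemma base_unit j : M j \in unitmx.
Proof. by apply: quot_diag_unit. Qed.

Lemma base_mxX_sub j d (c : F) :
  M j ^+ d - c%:M = quot_diag j (fun i => e (label j i) ^+ d - c).
Proof. by rewrite quot_diagX -(quot_diag_const j) quot_diagB. Qed.

Lemma base_mxX_sub_unit j d (c : F) :
  (forall a, e a ^+ d != c) -> M j ^+ d - c%:M \in unitmx.
Proof.
by move=> nc; rewrite base_mxX_sub quot_diag_unit // => i _; rewrite subr_eq0.
Qed.

(** Taking all four values of e gives one annihilating polynomial for every j; it feeds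
    [comm_sub_unitmx]. *)
Lemma base_annul j d : \prod_(a : 'I_4) (M j ^+ d - (e a ^+ d)%:M) = 0.
Proof.
under eq_bigr => a _ do rewrite base_mxX_sub.
rewrite quot_diag_prod; have -> : 0 = (0 : F)%:M :> 'M[F]_3 by rewrite raddf0.
rewrite -(quot_diag_const j); apply: eq_quot_diag => i _.
by rewrite (bigD1 (label j i)) //= subrr mul0r.
Qed.

Lemma pi4_base_mxX x j d :
  pi4 x *m M j ^+ d = pi4 (fun i => e (label j i) ^+ d * (x i - x j)).
Proof. by rewrite quot_diagX mul_pi4_diag. Qed.

(** For [pi4 x] in the left kernel, comparing coordinates j and k forces x_j = x_k by [label_anti];
    then each other coordinate i forces x_i = x_j by [label_col]. *)
Lemma base_sub_unit j k d : (0 < d <= 2)%N -> j != k ->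
  M j ^+ d - M k ^+ d \in unitmx.
Proof.
move=> /ed_inj ei njk; apply: unitmx_inj => u; have [x ->] := pi4_surj u.
rewrite mulmxBr !pi4_base_mxX pi4N pi4D => /(pi4_eq0 _ j) E.
have := E k; rewrite /= !subrr !mulr0 subr0 add0r => Ek.
have /eqP : (e (label j k) ^+ d - e (label k j) ^+ d) * (x k - x j) = 0.
  by rewrite mulrBl Ek; ring.
rewrite mulf_eq0 !subr_eq0 => /orP[/eqP/ei/label_anti/eqP|/eqP xkj].
  by rewrite (negbTE njk).
apply/(pi4_eq0 _ j) => i; have [->//|nij] := eqVneq i j.
have [->//|nik] := eqVneq i k.
have := E i; rewrite /= xkj !subrr !mulr0 subr0 -mulrBl => /eqP.
rewrite mulf_eq0 !subr_eq0 => /orP[/eqP/ei/label_col eqjk|/eqP //].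
by move: njk; rewrite eqjk ?eqxx.
Qed.

Lemma base_vec_mul j k : j != k ->
  base_vec F j *m M k = e (label k j) *: base_vec F j.
Proof.
move=> njk; rewrite mul_pi4_diag pi4Z; apply/pi4_eqP => i.
rewrite [k == j]eq_sym (negbTE njk).
by case: (eqVneq i j) => [->|_]; case: (eqVneq ord0 j) => [->|_];
  rewrite ?subr0 ?mulr0 ?mulr1 ?subrr.
Qed.

(** As v_j is minus the sum of the other v_i, a linear relation is a polynomial of degree at most 2
    vanishing at the three distinct eigenvalues of M_j. *)
Lemma base_cyclic j (c : 'rV[F]_3) :
  \sum_(k < 3) c 0 k *: (base_vec F j *m M j ^+ k) = 0 -> c = 0.
Proof.
rewrite !big_ord_recl big_ord0 !pi4_base_mxX !pi4Z addr0 !pi4D.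
move=> /(pi4_eq0 _ j) E.
set c0 := c 0 ord0 in E; set c1 := c 0 _ in E; set c2 := c 0 _ in E.
have P (k : 'I_3) (x := e (label j (lift j k))) : c0 + c1 * x + c2 * x ^+ 2 = 0.
  have := E (lift j k); rewrite /= eqxx eq_sym (negbTE (neq_lift j k)) subrr.
  rewrite !mulr0 !addr0 sub0r => H; apply/eqP; rewrite -oppr_eq0 -H -/x.
  by apply/eqP; rewrite /bump /=; ring.
have nx (k l : 'I_3) : k != l -> e (label j (lift j k)) != e (label j (lift j l)).
  apply: contra_neq => /e_inj/label_row; rewrite ![lift _ _ == _]eq_sym !neq_lift.
  by move=> /(_ isT isT) /lift_inj.
have [] := quadratic_eq0 (nx 0 1 isT) (nx 0 (1 + 1) isT) (nx 1 (1 + 1) isT)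
  (P 0) (P 1) (P (1 + 1)).
move=> z0 z1 z2; apply/rowP => k; rewrite mxE.
case: k => [[|[|[|?]]] ?] //.
- by rewrite -z0; congr (c _ _); apply: val_inj.
- by rewrite -z1; congr (c _ _); apply: val_inj.
- by rewrite -z2; congr (c _ _); apply: val_inj.
Qed.

(** The line of v_j is encoded as a square matrix so that the ring morphisms into larger matrix
    algebras apply to it. *)
Definition base_space (j : 'I_4) : 'M[F]_3 := \matrix_(k < 3) base_vec F j.

Lemma rank_base_space j : (\rank (base_space j) <= 1)%N.
Proof.
have -> : base_space j = const_mx 1 *m base_vec F j :> 'M_3.
  by apply/matrixP => a b; rewrite !mxE big_ord1 !mxE mul1r.
exact: mulmx_max_rank.
Qed.

Lemma base_space_mul j k : j != k ->
  base_space j *m M k = e (label k j) *: base_space j.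
Proof.
move=> njk; apply/row_matrixP => i.
by rewrite row_mul !linearZ /= !rowK base_vec_mul.
Qed.

(** Independence is stated with explicit cofactors because such an identity is preserved by ring
    morphisms. *)
Lemma base_space_full j :
  exists X : 'I_3 -> 'M[F]_3, \sum_k X k *m (base_space j *m M j ^+ k) = 1%:M.
Proof.
pose G : 'M[F]_3 := \matrix_k (base_vec F j *m M j ^+ k).
have uG : G \in unitmx.
  apply: unitmx_inj => c cG; apply: (@base_cyclic j); rewrite -[RHS]cG mulmx_sum_row.
  by apply: eq_bigr => k _; rewrite rowK.
(* The factor [delta_mx 0 0] extracts one copy of row k of G, so the sum becomes the column-by-row
   expansion of G^-1 G. *)
exists (fun k => col k (invmx G) *m delta_mx 0 0).
rewrite -(mulVmx uG); apply/matrixP => a b; rewrite summxE mxE.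
apply: eq_bigr => k _; rewrite -mulmxA.
have -> : delta_mx 0 0 *m (base_space j *m M j ^+ k) = row k G :> 'rV_3.
  by rewrite -rowE row_mul !rowK.
by rewrite mxE big_ord1 !mxE.
Qed.

End Base.

(** * The 3 x 3 block minors inside one factor *)

Section BaseTriple.
Variables (F : fieldType) (e : 'I_4 -> F).
Hypothesis e2_inj : injective (fun a => e a ^+ 2).
Local Notation M := (base_mx e).

(* [plane s a b] says that the functional X^k |-> s_k kills (X - e a)(X - e b). *)
Definition plane (s : nat -> F) (a b : 'I_4) :=
  s 2 - (e a + e b) * s 1 + e a * e b * s 0 = 0.

(** Consecutive quadratics share a root: the difference of the first two is a nonzero multiple of X
    - e b, that of the last two of X - e c. These two linear polynomials differ by a nonzero
    constant, so s kills everything of degree at most 2. *)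
Lemma plane_path s a b c d : a != c -> b != d -> b != c ->
  plane s a b -> plane s b c -> plane s c d -> [/\ s 0 = 0, s 1 = 0 & s 2 = 0].
Proof.
move=> nac nbd nbc Pab Pbc Pcd.
have sub_neq0 i j : i != j -> e i - e j != 0.
  by rewrite subr_eq0 (inj_eq (e_inj e2_inj)).
have E1 : s 1 - e b * s 0 = 0.
  apply: (mulfI (sub_neq0 _ _ nac)).
  by rewrite mulr0 -[RHS](subrr 0) -{1}Pbc -Pab; ring.
have E2 : s 1 - e c * s 0 = 0.
  apply: (mulfI (sub_neq0 _ _ nbd)).
  by rewrite mulr0 -[RHS](subrr 0) -{1}Pcd -Pbc; ring.
have s0 : s 0 = 0.
  apply: (mulfI (sub_neq0 _ _ nbc)).
  by rewrite mulr0 -[RHS](subrr 0) -{1}E2 -E1; ring.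
have s1 : s 1 = 0 by move: E1; rewrite s0 mulr0 subr0.
by move: Pab; rewrite /plane s0 s1 !mulr0 subr0 addr0.
Qed.

(** The index d marks the matrix left out; using four vectors, one of them zero, keeps the sums
    symmetric over ['I_4]. *)
Lemma base_triple (u : 'I_4 -> 'rV[F]_3) d : u d = 0 ->
  (forall k, (k < 3)%N -> \sum_j u j *m M j ^+ k = 0) -> forall j, u j = 0.
Proof.
move=> ud0 Eu.
have [x Ex] : exists x : 'I_4 -> 'I_4 -> F, forall j, u j = pi4 (x j).
  exists (fun j i => if unlift ord0 i is Some k then u j 0 k else 0) => j.
  by apply/rowP => k; rewrite !mxE liftK unlift_none subr0.
pose z j i := x j i - x j j.
have zd i : z d i = 0.
  have /(pi4_eq0 _ d) : pi4 (x d) = 0 by rewrite -Ex.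
  by move=> /(_ i) E; rewrite /z E subrr.
(* A vector with zero image under [pi4] has equal coordinates; [s k] is their common value, read off
   at d. *)
pose s k := \sum_j e (label j d) ^+ k * z j d.
have Es k i : (k < 3)%N -> \sum_j e (label j i) ^+ k * z j i = s k.
  move=> /Eu E.
  have : pi4 (fun i => \sum_j e (label j i) ^+ k * z j i) = 0.
    rewrite -E; apply/rowP => c; rewrite summxE mxE -sumrB.
    by apply: eq_bigr => j _; rewrite Ex pi4_base_mxX mxE.
  by move=> /(pi4_eq0 _ d).
have nlab a b i : a != b -> i != a -> i != b -> label a i != label b i.
  by move=> nab nia nib; apply: contraNneq nab => /label_col ->.
(* At coordinate i only p and q contribute, so s_k combines the k-th powers of two eigenvalues and
   kills the quadratic with these roots. *)
have Kpl i p q a b : uniq [:: d; i; p; q] -> label p i = a -> label q i = b ->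
    plane s a b.
  move=> u4 <- <-; rewrite /plane -!(Es _ i) // !(big_ord4_uniq _ u4) !zd.
  by rewrite /z subrr; ring.
have [s0 s1 s2] : [/\ s 0 = 0, s 1 = 0 & s 2 = 0].
  have eqL (p i a : 'I_4) : label p i == a -> label p i = a by move/eqP.
  (* For each d, the three other coordinates give the edges of the path found in the table. *)
  case: d ud0 zd @s Es Kpl => [[|[|[|[|?]]]] Hd] // _ _ s _ Kpl.
  - apply: (@plane_path s (inZp 3) (inZp 2) (inZp 0) (inZp 1)) => //.
    + by apply: (Kpl (inZp 1) (inZp 3) (inZp 2)) => //; apply: eqL.
    + by apply: (Kpl (inZp 2) (inZp 3) (inZp 1)) => //; apply: eqL.
    + by apply: (Kpl (inZp 3) (inZp 2) (inZp 1)) => //; apply: eqL.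
  - apply: (@plane_path s (inZp 3) (inZp 0) (inZp 2) (inZp 1)) => //.
    + by apply: (Kpl (inZp 0) (inZp 2) (inZp 3)) => //; apply: eqL.
    + by apply: (Kpl (inZp 3) (inZp 2) (inZp 0)) => //; apply: eqL.
    + by apply: (Kpl (inZp 2) (inZp 3) (inZp 0)) => //; apply: eqL.
  - apply: (@plane_path s (inZp 1) (inZp 2) (inZp 0) (inZp 3)) => //.
    + by apply: (Kpl (inZp 3) (inZp 1) (inZp 0)) => //; apply: eqL.
    + by apply: (Kpl (inZp 0) (inZp 1) (inZp 3)) => //; apply: eqL.
    + by apply: (Kpl (inZp 1) (inZp 0) (inZp 3)) => //; apply: eqL.
  - apply: (@plane_path s (inZp 3) (inZp 2) (inZp 0) (inZp 1)) => //.
    + by apply: (Kpl (inZp 0) (inZp 2) (inZp 1)) => //; apply: eqL.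
    + by apply: (Kpl (inZp 1) (inZp 2) (inZp 0)) => //; apply: eqL.
    + by apply: (Kpl (inZp 2) (inZp 1) (inZp 0)) => //; apply: eqL.
(* With s = 0, coordinate i is a Vandermonde system in the three matrices other than M_i, whose
   labels in column i are distinct. *)
move=> j; rewrite Ex; apply/(pi4_eq0 _ j) => i; apply/eqP; rewrite -subr_eq0.
apply/eqP; rewrite -/(z j i).
have [->|nij] := eqVneq i j; first by rewrite /z subrr.
have [p [q u4]] := complete4 nij.
have [nip [niq [njp [njq npq]]]] : i != p /\ i != q /\ j != p /\ j != q /\ p != q.
  by move: u4; rewrite /= !inE !negb_or => /and4P[/and3P[_ -> ->] /andP[-> ->] -> _].
have zi : z i i = 0 by rewrite /z subrr.
have e_neq a b : label a i != label b i -> e (label a i) != e (label b i).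
  by rewrite (inj_eq (e_inj e2_inj)).
have := vandermonde3 (a := z j i) (b := z p i) (c := z q i)
  (e_neq _ _ (nlab j p i njp nij nip)) (e_neq _ _ (nlab j q i njq nij niq))
  (e_neq _ _ (nlab p q i npq nip niq)).
have Ei k : (k < 3)%N -> e (label j i) ^+ k * z j i + e (label p i) ^+ k * z p i +
     e (label q i) ^+ k * z q i = 0.
  move=> lk3; have := Es k i lk3; rewrite (big_ord4_uniq _ u4) zi mulr0 add0r => ->.
  by case: k lk3 => [|[|[|]]].
case=> //.
- by have := Ei 0 isT; rewrite !mul1r.
- by have := Ei 1 isT.
- exact: Ei 2 isT.
Qed.

(** The elimination is run backwards: a kernel vector x of [schur3] yields the kernel vector (v, -w,
    w - v) of the block Vandermonde matrix, which [base_triple] kills. *)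
Lemma base_schur3 a b c : a != b -> a != c -> b != c ->
  schur3 (M a) (M b) (M c) \in unitmx.
Proof.
move=> nab nac nbc.
have [d] : exists d, d \in ~: [set a; b; c].
  apply/card_gt0P; rewrite cardsCs setCK card_ord subn_gt0 ltnS setUC.
  by rewrite cardsU1 cards2; case: (_ \notin _); case: (_ != _).
rewrite !inE !negb_or => /andP[/andP[nda ndb] ndc].
have u4 : uniq [:: a; b; c; d].
  by rewrite /= !inE !negb_or nab nac nbc [a == d]eq_sym [b == d]eq_sym
    [c == d]eq_sym nda ndb ndc.
have uac : M a - M c \in unitmx by exact: (base_sub_unit e2_inj (d := 1)).
have ubc : M b - M c \in unitmx by exact: (base_sub_unit e2_inj (d := 1)).
apply: unitmx_inj => x; rewrite /schur3 mulmxBr !mulmxA.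
set v := x *m invmx (M a - M c); set w := x *m invmx (M b - M c) => E.
have Ev : v *m (M a - M c) = x by rewrite mulmxKV.
have Ew : w *m (M b - M c) = x by rewrite mulmxKV.
pose u j :=
  if j == a then v else if j == b then - w else if j == c then w - v else 0.
have ua : u a = v by rewrite /u eqxx.
have ub : u b = - w by rewrite /u eq_sym (negbTE nab) eqxx.
have uc : u c = w - v.
  by rewrite /u [c == a]eq_sym [c == b]eq_sym (negbTE nac) (negbTE nbc) eqxx.
have ud : u d = 0 by rewrite /u (negbTE nda) (negbTE ndb) (negbTE ndc).
suff /(_ a) : forall j, u j = 0 by rewrite ua -Ev => ->; rewrite mul0mx.
have Eu k : \sum_j u j *m M j ^+ k =
    v *m (M a ^+ k - M c ^+ k) - w *m (M b ^+ k - M c ^+ k).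
  rewrite (big_ord4_uniq _ u4) ua ub uc ud mul0mx addr0 !mulmxBr mulNmx mulmxBl.
  by rewrite opprB [X in _ + X = _]addrC addrACA [X in _ + X = _]addrC.
refine (base_triple ud _) => -[|[|[|k]]] // _; rewrite Eu //.
- by rewrite !subrr !mulmx0 subrr.
- by rewrite !expr1 Ev Ew subrr.
Qed.

End BaseTriple.

(** * Tensor powers *)

Section TensorEmbedding.
Variable F : fieldType.

Definition tens_left n p (A : 'M[F]_n) : 'M_(n * p) := tensmx A 1%:M.
Definition tens_right n p (A : 'M[F]_p) : 'M_(n * p) := tensmx 1%:M A.

Lemma tensmx_scalar n p (a b : F) : tensmx (a%:M : 'M_n) (b%:M : 'M_p) = (a * b)%:M.
Proof.
apply/matrixP => i j.
case: (mxtens_indexP i)=> i0 i1; case: (mxtens_indexP j)=> j0 j1.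
rewrite tensmxE !mxE (can_eq (@mxtens_indexK _ _)) xpair_eqE.
by case: eqP; case: eqP => //= _ _; rewrite ?mulr0n ?mulr1n ?mulr0 ?mul0r.
Qed.

Fact tens_left_zmod n p : zmod_morphism (@tens_left n p).
Proof. by move=> A B; apply/matrixP => i j; rewrite !mxE mulrBl. Qed.

Fact tens_left_monoid n p : monoid_morphism (@tens_left n p).
Proof.
split=> [|A B]; first by rewrite /tens_left tensmx_scalar mulr1.
by rewrite -[RHS]/(tensmx A 1%:M *m tensmx B 1%:M) tensmx_mul mulmx1.
Qed.

Fact tens_right_zmod n p : zmod_morphism (@tens_right n p).
Proof. by move=> A B; apply/matrixP => i j; rewrite !mxE mulrBr. Qed.

Fact tens_right_monoid n p : monoid_morphism (@tens_right n p).
Proof.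
split=> [|A B]; first by rewrite /tens_right tensmx_scalar mulr1.
by rewrite -[RHS]/(tensmx 1%:M A *m tensmx 1%:M B) tensmx_mul mulmx1.
Qed.

HB.instance Definition _ n p :=
  GRing.isZmodMorphism.Build _ _ (@tens_left n p) (@tens_left_zmod n p).
HB.instance Definition _ n p :=
  GRing.isMonoidMorphism.Build _ _ (@tens_left n p) (@tens_left_monoid n p).
HB.instance Definition _ n p :=
  GRing.isZmodMorphism.Build _ _ (@tens_right n p) (@tens_right_zmod n p).
HB.instance Definition _ n p :=
  GRing.isMonoidMorphism.Build _ _ (@tens_right n p) (@tens_right_monoid n p).

Lemma rank_tensmx n p n' p' (A : 'M[F]_(n, n')) (B : 'M[F]_(p, p')) :
  (\rank (tensmx A B) <= \rank A * \rank B)%N.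
Proof.
by rewrite -{1}[A]mulmx_base -{1}[B]mulmx_base -tensmx_mul mulmx_max_rank.
Qed.

(** By induction, the new factor embeds on the left and the old ones on the right. An upper bound on
    the rank is enough, since independence supplies the lower one. *)
Lemma tensor_embeddings m l : l = (3 ^ m)%N ->
  exists E : 'I_m -> {rmorphism 'M[F]_3 -> 'M[F]_l},
  [/\ forall i c, E i c%:M = c%:M,
      forall i j A B, i != j -> E i A *m E j B = E j B *m E i A &
      forall i A, (3 * \rank (E i A) <= \rank A * l)%N].
Proof.
elim: m l => [|m IHm] l.
  by exists (fun i : 'I_0 => False_rect _ (notF (ltn_ord i))); split=> -[].
rewrite expnS => ->; have [E [Escal Ecomm Erank]] := IHm _ erefl.
exists (fun i => if unlift ord0 i is Some i' then
  tens_right 3 (p := (3 ^ m)%N) \o E i' : {rmorphism _ -> _}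
  else tens_left (3 ^ m)%N).
split=> [i c|i j A B|i A].
- by case: unliftP => [i'|] _ /=; rewrite ?Escal -[LHS]/(tensmx _ _)
    tensmx_scalar ?mul1r ?mulr1.
- case: unliftP => [i'|] ->; case: unliftP => [j'|] ->.
  + rewrite (inj_eq lift_inj) => nij /=.
    by rewrite /tens_right !tensmx_mul Ecomm.
  + by move=> _ /=; rewrite /tens_left /tens_right !tensmx_mul !mulmx1 !mul1mx.
  + by move=> _ /=; rewrite /tens_left /tens_right !tensmx_mul !mulmx1 !mul1mx.
  + by rewrite eqxx.
- case: unliftP => [i'|] _ /=.
    apply: leq_trans (_ : 3 * (3 * \rank (E i' A)) <= _)%N.
      by rewrite leq_mul2l (leq_trans (rank_tensmx _ _)) // mxrank1.
    by rewrite mulnCA leq_mul2l Erank.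
  by rewrite mulnCA leq_mul2l (leq_trans (rank_tensmx _ _)) // mxrank1.
Qed.

End TensorEmbedding.

(** Greedy choice: a new element must avoid 0, the n chosen elements and their opposites, at most 2n
    + 1 values. *)
Lemma exists_distinct_squares (F : finFieldType) n : (2 * n < #|F|)%N ->
  exists s : seq F, [/\ size s = n, 0 \notin s & uniq [seq x ^+ 2 | x <- s]].
Proof.
elim: n => [_|n IHn ltnF]; first by exists [::].
have [|s [sz s0 us]] := IHn.
  by apply: leq_ltn_trans ltnF; rewrite leq_mul2l leqnSn.
pose bad := 0 :: s ++ [seq - x | x <- s].
have [x] : exists x, x \in [predC bad].
  apply/card_gt0P; rewrite -(ltn_add2l #|bad|) addn0 cardC.
  apply: leq_ltn_trans (card_size bad) _.
  rewrite /= size_cat size_map sz addnn -mul2n.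
  by apply: ltn_trans ltnF; rewrite mulnS.
rewrite inE /= inE mem_cat !negb_or => /and3P[x0 xs xNs].
exists (x :: s); rewrite /= sz us inE eq_sym negb_or x0 s0; split=> //.
rewrite andbT; apply: contra xs => /mapP[y ys /eqP].
rewrite eqf_sqr => /orP[/eqP -> //|/eqP xy].
by case/negP: xNs; rewrite xy map_f.
Qed.

(** * The family on the tensor power *)

Section Family.
Variables (F : fieldType) (m l : nat) (E : 'I_m -> {rmorphism 'M[F]_3 -> 'M[F]_l}).
Variable e : 'I_m -> 'I_4 -> F.
Hypothesis Escal : forall i c, E i c%:M = c%:M.
Hypothesis Ecomm : forall i j A B, i != j -> E i A *m E j B = E j B *m E i A.
Hypothesis e_neq0 : forall i a, e i a != 0.
Hypothesis e2_inj : forall i j a b, e i a ^+ 2 = e j b ^+ 2 -> i = j /\ a = b.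

Lemma e2_inj_at i : injective (fun a => e i a ^+ 2).
Proof. by move=> a b /e2_inj[]. Qed.

Definition fam_mx (p : 'I_4 * 'I_m) := E p.2 (base_mx (e p.2) p.1).
Definition fam_space (p : 'I_4 * 'I_m) := E p.2 (base_space F p.1).

Lemma fam_unit p : fam_mx p \in unitmx.
Proof. by apply/rmorph_unitmx/base_unit. Qed.

Lemma fam_comm p q : p.2 != q.2 -> fam_mx p *m fam_mx q = fam_mx q *m fam_mx p.
Proof. exact: Ecomm. Qed.

Lemma fam_sub_unit p q d : p != q -> (0 < d <= 2)%N ->
  fam_mx p ^+ d - fam_mx q ^+ d \in unitmx.
Proof.
case: p q => [a i] [b j]; rewrite xpair_eqE /fam_mx /= => npq ld.
rewrite -!rmorphXn; have [eij|nij] := eqVneq i j.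
  move: npq; rewrite -{}eij eqxx andbT => nab.
  by rewrite -rmorphB rmorph_unitmx // (base_sub_unit (@e2_inj_at i)).
(* Across factors, the polynomial annihilating the first power has no root among the eigenvalues of
   the second. *)
apply: (@comm_sub_unitmx _ _ _ _ _ (fun c => e i c ^+ d)).
- exact: Ecomm.
- under eq_bigr => c _ do rewrite -(Escal i) -rmorphB.
  by rewrite -rmorph_prod base_annul rmorph0.
- move=> c; rewrite -(Escal j) -rmorphB rmorph_unitmx //.
  apply: base_mxX_sub_unit => c'; apply: contraNneq nij => eq_d.
  have /e2_inj[-> //] : e i c ^+ 2 = e j c' ^+ 2.
  by case: d ld eq_d => [|[|[|d]]] // _; rewrite ?expr1 => ->.
Qed.

(** Either all three share a factor, or one lies in a factor different from those of the other two
    and commutes with both; rotation puts that one last. *)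
Lemma fam_vand3 p q s : p != q -> p != s -> q != s ->
  vand3_inj (fam_mx p) (fam_mx q) (fam_mx s).
Proof.
move=> npq nps nqs.
have sub1 x y : x != y -> fam_mx x - fam_mx y \in unitmx.
  by move=> nxy; exact: (fam_sub_unit (d := 1)).
have pivot x y z : x != y -> x != z -> y != z -> x.2 != z.2 -> y.2 != z.2 ->
    vand3_inj (fam_mx x) (fam_mx y) (fam_mx z).
  by move=> *; apply: vand3_inj_comm; rewrite ?sub1 // fam_comm.
have [eps|nps2] := eqVneq p.2 s.2; have [eqs|nqs2] := eqVneq q.2 s.2.
- case: p q s npq nps nqs eps eqs {pivot} sub1 => [a i] [b j] [c k] /=.
  rewrite !xpair_eqE => + + + eik ejk; subst i j.
  rewrite eqxx !andbT => nab nac nbc sub1.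
  have e2i := @e2_inj_at k.
  apply: vand3_inj_schur; try by apply: sub1; rewrite xpair_eqE negb_and ?nac ?nbc.
  rewrite /fam_mx /= -rmorph_schur3 ?(base_sub_unit e2i (d := 1)) //.
  by rewrite rmorph_unitmx // base_schur3.
- by apply: vand3_inj_rot; apply: (pivot s p q); rewrite ?eps // eq_sym.
- by do 2!apply: vand3_inj_rot; apply: (pivot q s p); rewrite ?eqs // eq_sym.
- exact: pivot.
Qed.

(** Across factors the matrix moves to the left, where an invertible matrix preserves the row space;
    within a factor it acts as a nonzero scalar. *)
Lemma fam_space_mul p q : p != q -> (fam_space p *m fam_mx q == fam_space p)%MS.
Proof.
case: p q => [a i] [b j]; rewrite xpair_eqE /fam_space /fam_mx /= => npq.
have [eij|nij] := eqVneq i j; last first.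
  rewrite (Ecomm _ _ nij); apply/eqmxP/eqmxMfull; rewrite row_full_unit.
  exact: rmorph_unitmx (base_unit (e_neq0 j) b).
move: npq; rewrite -{}eij eqxx andbT => nab.
rewrite -[_ *m _]rmorphM -mulmxE base_space_mul // -mul_scalar_mx mulmxE.
rewrite rmorphM Escal.
by rewrite -mulmxE mul_scalar_mx; apply/eqmxP/eqmx_scale.
Qed.

Lemma fam_space_full p : (\sum_(j < 3) (fam_space p *m fam_mx p ^+ j) == 1%:M)%MS.
Proof.
rewrite submx1 /=; apply/sub_sumsmxP; case: p => [a i] /=.
have [X X1] := base_space_full (@e2_inj_at i) a.
exists (fun k => E i (X k)); rewrite -(Escal i) -X1 rmorph_sum.
apply: eq_bigr => k _; rewrite /fam_space /fam_mx /=.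
by rewrite !mulmxE !rmorphM rmorphXn.
Qed.

(** Three images of the space, each of at most its rank, span everything, which gives the reverse
    inequality. *)
Lemma fam_space_rank p : (3 * \rank (fam_space p) <= l)%N ->
  (3 * \rank (fam_space p) = l)%N.
Proof.
move=> le_l; apply/eqP; rewrite eqn_leq le_l.
have := fam_space_full p; rewrite submx1 => /mxrankS; rewrite mxrank1.
move/leq_trans; apply.
apply: (@leq_trans (\sum_(j < 3) \rank (fam_space p *m fam_mx p ^+ j))).
  elim/big_rec2: _ => [|j r A _ le_Ar]; first by rewrite mxrank0.
  by apply: leq_trans (mxrank_adds_leqif _ _) _; rewrite leq_add2l.
rewrite -[3%N in leqRHS]card_ord -sum_nat_const leq_sum // => j _.
exact: mxrankM_maxl.
Qed.

End Family.

Theorem theorem6p7 :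
  exists c : nat,
  forall (m : nat) (F : finFieldType),
    (0 < m)%N ->
    (3 %| #|F| - 1)%N ->
    (maxn (42 * m) c + 1 < #|F|)%N ->
    exists (A : 'I_(4 * m) -> 'M[F]_(3 ^ m)) (S : 'I_(4 * m) -> 'M[F]_(3 ^ m)),
      (forall i, A i \in unitmx) /\
      (forall i, \rank (S i) = (3 ^ m.-1)%N) /\
      subspace_condition 3 (3 ^ m)%N A S.
Proof.
(* The 4m distinct squares ask for 8m < q, which follows from 42m + 1 < q. *)
exists 0%N => m F m_gt0 _ ltF.
have [|s [size_s s0 s2_uniq]] := @exists_distinct_squares F (4 * m).
  by apply: leq_ltn_trans ltF; rewrite maxn0; lia.
have [E [Escal Ecomm Erank]] := @tensor_embeddings F m _ erefl.
(* The pairing of ['I_4] and ['I_m] with ['I_(4 * m)] gives each factor its own four entries of s;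
   its inverse also enumerates the family. *)
pose e (i : 'I_m) (a : 'I_4) := nth 0 s (mxtens_index (a, i)).
have lt_s (k : 'I_(4 * m)) : (k < size s)%N by rewrite size_s.
have e_neq0 i a : e i a != 0 by apply: contraNneq s0 => <-; rewrite mem_nth.
have e2_inj i j a b : e i a ^+ 2 = e j b ^+ 2 -> i = j /\ a = b.
  rewrite /e -!(nth_map 0 0 (fun x => x ^+ 2)) // => /eqP.
  rewrite nth_uniq ?size_map // => /eqP/val_inj eq_ab.
  by have [] := can_inj (@mxtens_indexK 4 m) eq_ab.
have unindex_inj : injective (@mxtens_unindex 4 m) := can_inj (@mxtens_unindexK 4 m).
pose A k := fam_mx E e (mxtens_unindex k).
pose S k := fam_space E (mxtens_unindex k).
have uA k : A k \in unitmx by exact: fam_unit.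
have expm : (3 * 3 ^ m.-1 = 3 ^ m)%N by rewrite -expnS prednK.
have rS k : \rank (S k) = (3 ^ m.-1)%N.
  apply/eqP; rewrite -(eqn_pmul2l (isT : 0 < 3)%N) expm; apply/eqP.
  apply: (@fam_space_rank _ _ _ E e) => //.
  apply: leq_trans (Erank _ _) _; rewrite -[X in (_ <= X)%N]mul1n leq_mul2r.
  by rewrite rank_base_space orbT.
exists A, S; split=> //; split=> //; split=> //; split.
  by move=> k; rewrite rS -expm mulKn.
split=> [k|]; first exact: fam_space_full.
split=> [k k' nkk'|t rows cols].
  by apply: fam_space_mul; rewrite ?(inj_eq unindex_inj).
apply: block_submx3_unit => // [p q d npq|p q r npq npr nqr].
  by apply: fam_sub_unit; rewrite ?(inj_eq unindex_inj).
by apply: fam_vand3; rewrite ?(inj_eq unindex_inj).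
Qed.
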